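(* Let $G$ be a finite group, $K$ a finite field, $\Theta\in\mathrm{Hom}(G,\mathrm{Aut}(K))$, and let $\alpha:G\times G\to K^*$ be a normalized $2$-cocycle of $G$ stabilized by $\Theta(G)$. If $C\neq0$ is a left ideal of the twisted skew group ring $K[G,\Theta,\alpha]$ with minimum (Hamming) distance $\mathrm d(C)$, then $$|G|\le \mathrm d(C)\cdot\dim_K C.$$
   Context: A normalized $2$-cocycle of $G$ is a map $\alpha:G\times G\to K^*$ with $\alpha(g,1)=\alpha(1,g)=1$ for all $g$ and $\alpha(g_1,g_2g_3)\alpha(g_2,g_3)=\alpha(g_1g_2,g_3)\alpha(g_1,g_2)$ for all $g_1,g_2,g_3\in G$. It is stabilized by $\Theta(G)$ if $\Theta(g)(\alpha(x,y))=\alpha(x,y)$ for all $g,x,y\in G$. The twisted skew group ring $K[G,\Theta,\alpha]$ is the left $K$-vector space with basis $\{\overline g\mid g\in G\}$ and multiplication $\sum_g a_g\overline g\cdot\sum_h b_h\overline h=\sum_{g,h}a_g(\Theta(g)b_h)\alpha(g,h)\overline{gh}$; it is an associative ring with identity $\overline1$. Left ideals are left $K$-subspaces, and $\dim_K$ is the left $K$-dimension. The weight of $\sum_g a_g\overline g$ is the number of $g$ with $a_g\ne0$, and $\mathrm d(C)$ is the minimum weight of a nonzero element of $C$. *)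

(* Defs.v *)
From HB Require Import structures.
From mathcomp Require Import all_boot all_order all_fingroup all_algebra.

Set Implicit Arguments.
Unset Strict Implicit.
Unset Printing Implicit Defensive.

Import GRing.Theory.
Local Open Scope ring_scope.

(* A ring endomorphism of a finite field is injective, hence bijective, so
   {rmorphism K -> K} is Aut(K).  Its group law is composition of functions
   acting on the left; a multiplicative map into a group sends 1 to 1, so no
   separate condition on Theta 1 is needed. *)
Definition hom_to_Aut (gT : finGroupType) (K : finFieldType)
    (Theta : gT -> {rmorphism K -> K}) : Prop :=
  forall (g h : gT) (x : K), Theta (g * h)%g x = Theta g (Theta h x).

(* The products of values of alpha are taken in the multiplicative group K^*,
   represented by {unit K}; FinRing.uval is its inclusion into K. *)
Definition normalized_cocycle (gT : finGroupType) (K : finFieldType)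
    (alpha : gT -> gT -> {unit K}) : Prop :=
  (forall g : gT, alpha g 1%g = 1%g /\ alpha 1%g g = 1%g) /\
  (forall g1 g2 g3 : gT,
     (alpha g1 (g2 * g3) * alpha g2 g3 = alpha (g1 * g2) g3 * alpha g1 g2)%g).

Definition stabilized (gT : finGroupType) (K : finFieldType)
    (Theta : gT -> {rmorphism K -> K}) (alpha : gT -> gT -> {unit K}) : Prop :=
  forall g x y : gT,
    Theta g (FinRing.uval (alpha x y)) = FinRing.uval (alpha x y).

(* The coefficient function a : gT -> K stands for \sum_g a g *: bar g.  The
   hypotheses on Theta and alpha are arguments of the type because the ring
   structure declared on it below depends on them.  K^o is K viewed as a left
   vector space over itself. *)
Definition tsgr (gT : finGroupType) (K : finFieldType)
    (Theta : gT -> {rmorphism K -> K}) (alpha : gT -> gT -> {unit K})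
    (ThetaM : hom_to_Aut Theta) (alphaP : normalized_cocycle alpha)
    (alphaS : stabilized Theta alpha) : Type :=
  {ffun gT -> K^o}.

Section TwistedSkewGroupRing.

Variables (gT : finGroupType) (K : finFieldType).
Variables (Theta : gT -> {rmorphism K -> K}) (alpha : gT -> gT -> {unit K}).
Hypotheses (ThetaM : hom_to_Aut Theta) (alphaP : normalized_cocycle alpha).
Hypothesis alphaS : stabilized Theta alpha.

Local Notation A := (tsgr ThetaM alphaP alphaS).
Local Notation "alpha %:K" := (FinRing.uval alpha) (at level 2, format "alpha %:K").

HB.instance Definition _ := Finite.copy A {ffun gT -> K^o}.
HB.instance Definition _ := Vector.copy A {ffun gT -> K^o}.

Definition bar (g : gT) : A := [ffun h => (h == g)%:R].

Definition tsgr_mul (a b : A) : A :=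
  \sum_(g : gT) \sum_(h : gT)
    (a g * Theta g (b h) * (alpha g h)%:K) *: bar (g * h)%g.

Lemma tsgr_basis (a : A) : a = \sum_(g : gT) a g *: bar g.
Proof.
apply/ffunP => h; rewrite sum_ffunE (bigD1 h) //= !ffunE eqxx.
rewrite big1 ?addr0 => [|g /negbTE gh]; first by rewrite /GRing.scale /= mulr1.
by rewrite !ffunE eq_sym gh scaler0.
Qed.

Lemma Theta1 (x : K) : Theta 1%g x = x.
Proof. by apply: (fmorph_inj (Theta 1%g)); rewrite -ThetaM mulg1. Qed.

Lemma tsgr_mulDl : left_distributive tsgr_mul +%R.
Proof.
move=> a b c; rewrite /tsgr_mul -big_split; apply: eq_bigr => g _ /=.
rewrite -big_split; apply: eq_bigr => h _ /=.
by rewrite ffunE !mulrDl scalerDl.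
Qed.

Lemma tsgr_mulDr : right_distributive tsgr_mul +%R.
Proof.
move=> a b c; rewrite /tsgr_mul -big_split; apply: eq_bigr => g _ /=.
rewrite -big_split; apply: eq_bigr => h _ /=.
by rewrite ffunE rmorphD mulrDr mulrDl scalerDl.
Qed.

Lemma tsgr_mulZl (x : K) (a b : A) :
  x *: tsgr_mul a b = tsgr_mul (x *: a) b.
Proof.
rewrite /tsgr_mul scaler_sumr; apply: eq_bigr => g _ /=.
rewrite scaler_sumr; apply: eq_bigr => h _ /=.
by rewrite ffunE scalerA !mulrA.
Qed.

Lemma tsgr_mul0l (b : A) : tsgr_mul 0 b = 0.
Proof. by apply: (addrI (tsgr_mul 0 b)); rewrite -tsgr_mulDl !addr0. Qed.

Lemma tsgr_mul0r (a : A) : tsgr_mul a 0 = 0.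
Proof. by apply: (addrI (tsgr_mul a 0)); rewrite -tsgr_mulDr !addr0. Qed.

Lemma tsgr_mul_suml (F : gT -> A) (b : A) :
  tsgr_mul (\sum_g F g) b = \sum_g tsgr_mul (F g) b.
Proof.
exact: (big_morph (fun a => tsgr_mul a b) (fun a c => tsgr_mulDl a c b)
  (tsgr_mul0l b)).
Qed.

Lemma tsgr_mul_sumr (F : gT -> A) (a : A) :
  tsgr_mul a (\sum_g F g) = \sum_g tsgr_mul a (F g).
Proof. exact: (big_morph (tsgr_mul a) (tsgr_mulDr a) (tsgr_mul0r a)). Qed.

Lemma tsgr_mul_bar (x y : K) (g h : gT) :
  tsgr_mul (x *: bar g) (y *: bar h)
    = (x * Theta g y * (alpha g h)%:K) *: bar (g * h)%g.
Proof.
rewrite /tsgr_mul (bigD1 g) //= [X in _ + X]big1 => [|g' ng]; last first.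
  rewrite big1 // => h' _.
  by rewrite !ffunE (negbTE ng) scaler0 !mul0r scale0r.
rewrite addr0 (bigD1 h) //= big1 => [|h' nh]; last first.
  by rewrite !ffunE (negbTE nh) scaler0 rmorph0 mulr0 mul0r scale0r.
by rewrite addr0 !ffunE !eqxx /GRing.scale /= !mulr1.
Qed.

Lemma tsgr_mulA : associative tsgr_mul.
Proof.
have coefP (a : A) : exists f : gT -> K, a = \sum_(g : gT) f g *: bar g.
  by exists a; apply: tsgr_basis.
have := tsgr_mul_bar; have := tsgr_mul_sumr; have := tsgr_mul_suml.
move: tsgr_mul => m suml sumr mbar a b c.
have [[fa ->] [fb ->] [fc ->]] := And3 (coefP a) (coefP b) (coefP c).
rewrite !suml; apply: eq_bigr => g _.
rewrite !(sumr _ (fa g *: bar g)) suml; apply: eq_bigr => h _.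
rewrite !sumr; apply: eq_bigr => k _.
rewrite !mbar mulgA; congr (_ *: _).
have [_ cocyc] := alphaP.
have /(congr1 FinRing.uval) := cocyc g h k; rewrite /= => e.
rewrite !rmorphM /= alphaS ThetaM -!mulrA; congr (_ * (_ * _)).
by rewrite [RHS]mulrCA; congr (_ * _); rewrite mulrC e mulrC.
Qed.

Lemma tsgr_mul1l : left_id (bar 1%g) tsgr_mul.
Proof.
move=> a; rewrite {1}(tsgr_basis a) tsgr_mul_sumr [RHS]tsgr_basis.
apply: eq_bigr => g _; rewrite -(scale1r (bar 1%g)) tsgr_mul_bar.
by rewrite Theta1 mul1g (alphaP.1 g).2 mulr1 mul1r.
Qed.

Lemma tsgr_mul1r : right_id (bar 1%g) tsgr_mul.
Proof.
move=> a; rewrite {1}(tsgr_basis a) tsgr_mul_suml [RHS]tsgr_basis.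
apply: eq_bigr => g _; rewrite -(scale1r (bar 1%g)) tsgr_mul_bar.
by rewrite rmorph1 mulg1 (alphaP.1 g).1 !mulr1.
Qed.

Lemma tsgr_1neq0 : bar 1%g != 0.
Proof.
apply/eqP => /ffunP /(_ 1%g); rewrite !ffunE eqxx => /eqP.
by rewrite oner_eq0.
Qed.

HB.instance Definition _ := GRing.Zmodule_isNzRing.Build A
  tsgr_mulA tsgr_mul1l tsgr_mul1r tsgr_mulDl tsgr_mulDr tsgr_1neq0.

HB.instance Definition _ :=
  GRing.LSemiModule_isLSemiAlgebra.Build K A tsgr_mulZl.

Definition weight (a : A) : nat := #|[set g : gT | a g != 0]|.

(* Every weight is at most #|gT|, so the neutral value #|gT| of minn does not
   affect the minimum as soon as C contains a nonzero element. *)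
Definition min_distance (C : {vspace A}) : nat :=
  \big[minn/#|gT|]_(c : A | (c \in C) && (c != 0)) weight c.

Definition left_ideal (C : {vspace A}) : Prop :=
  forall a c : A, c \in C -> a * c \in C.

Lemma min_distance_le (C : {vspace A}) (c : A) :
  c \in C -> c != 0 -> (min_distance C <= weight c)%N.
Proof.
move=> cC c0; rewrite /min_distance.
elim: (index_enum _) (mem_index_enum c) => // x s IHs.
rewrite inE big_cons => /predU1P[<-|/IHs le_s]; first by rewrite cC c0 geq_minl.
by case: ifP => // _; apply: leq_trans (geq_minr _ _) le_s.
Qed.

Lemma min_distance_attained (C : {vspace A}) :
  C != 0%VS -> exists2 c : A, (c \in C) && (c != 0) & weight c = min_distance C.
Proof.
rewrite -vpick0 => C0; rewrite /min_distance.
have : (\big[minn/#|gT|]_(c : A | (c \in C) && (c != 0%R)) weight c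
          == #|gT|)%N \/
       exists2 c : A, (c \in C) && (c != 0) &
         weight c = \big[minn/#|gT|]_(c : A | (c \in C) && (c != 0)) weight c.
  apply: (big_ind (fun m => (m == #|gT|) \/
    exists2 c : A, (c \in C) && (c != 0) & weight c = m)); first by left.
    by move=> m n Hm Hn; rewrite /minn; case: ifP.
  by move=> c Hc; right; exists c.
case=> // /eqP Hm; exists (vpick C); first by rewrite memv_pick.
apply/eqP; rewrite eqn_leq {1}Hm max_card /=.
by apply: min_distance_le; rewrite ?memv_pick.
Qed.

End TwistedSkewGroupRing.

(* Main.v *)
Require Import Defs.
From mathcomp Require Import all_boot all_order all_fingroup all_algebra.

(* The translates bar g * c of a minimum-weight codeword c all have weight d(C),
   lie in C, and their supports cover G.  A space spanned by vectors of weight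
   at most d has joint support of size at most d times its dimension, since a
   vector depending on earlier ones adds nothing to the joint support. *)

Local Open Scope ring_scope.

Set Implicit Arguments.
Unset Strict Implicit.

Import GRing.Theory.

Lemma span_eval_eq0 (I : finType) (K : fieldType) (X : seq {ffun I -> K^o})
    (v : {ffun I -> K^o}) (i : I) :
  v \in <<X>>%VS -> {in X, forall x : {ffun I -> K^o}, x i = 0} -> v i = 0.
Proof.
move=> vX X0; rewrite (coord_span (X := in_tuple X) vX) sum_ffunE big1 // => j _.
by rewrite ffunE X0 ?scaler0 // mem_nth.
Qed.

(** Induction on [X]: a head vector outside the span of the tail raises the dimension by one and
    adds at most [d] indices; otherwise both sides stay under control of the tail. *)
Lemma card_supp_span (I : finType) (K : fieldType) (d : nat)
    (X : seq {ffun I -> K^o}) :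
  {in X, forall x : {ffun I -> K^o}, (#|[set i | x i != 0%R]| <= d)%N} ->
  (#|[set i | has (fun x : {ffun I -> K^o} => x i != 0%R) X]| <= d * \dim <<X>>)%N.
Proof.
elim: X => [|x X IHX] wX.
  by rewrite (_ : [set _ | _] = set0) ?cards0 //; apply/setP => i; rewrite !inE.
have {}IHX : (#|[set i | has (fun x : {ffun I -> K^o} => x i != 0%R) X]|
    <= d * \dim <<X>>)%N by apply: IHX => y yX; apply: wX; rewrite inE yX orbT.
rewrite span_cons; have [xX | xNX] := boolP (x \in <<X>>%VS).
  rewrite (addv_idPr _) -?memvE //; apply: leq_trans IHX.
  apply/subset_leq_card/subsetP => i; rewrite !inE /= => /orP[|//].
  (* Contrapositive: where all vectors of the tail vanish, so does [x], being a combination of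
     them. *)
  apply: contraR => /hasPn X0; apply/eqP.
  by apply: (span_eval_eq0 xX) => y /X0; rewrite negbK => /eqP.
have x0 : x != 0 by apply: contraNneq xNX => ->; rewrite mem0v.
(* The line of [x] meets the span trivially: if [k *: x] lies in it with [k] nonzero, then so does
   [x]. *)
rewrite dimv_disjoint_sum; last first.
  apply/eqP; rewrite -subv0; apply/subvP => v.
  rewrite memv_cap memv0 => /andP[/vlineP[k ->] kxX].
  move: kxX; rewrite rpredZeq (negbTE xNX) orbF => /eqP->.
  by rewrite scale0r.
rewrite dim_vline x0 mulnDr muln1.
apply: leq_trans (leq_add (wX x (mem_head _ _)) IHX).
apply: leq_trans (leq_card_setU _ _).
by apply/subset_leq_card/subsetP => i; rewrite !inE.
Qed.

(** Left translation by [g] is injective on the group, so of all terms of [c] only the one at [h]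
    reaches position [g * h]. *)
Lemma bar_mulE (gT : finGroupType) (K : finFieldType)
    (Theta : gT -> {rmorphism K -> K}) (alpha : gT -> gT -> {unit K})
    (ThetaM : hom_to_Aut Theta) (alphaP : normalized_cocycle alpha)
    (alphaS : stabilized Theta alpha)
    (c : tsgr ThetaM alphaP alphaS) (g h : gT) :
  (bar ThetaM alphaP alphaS g * c) (g * h)%g
    = Theta g (c h) * FinRing.uval (alpha g h).
Proof.
have barM k : bar ThetaM alphaP alphaS g * (c k *: bar ThetaM alphaP alphaS k)
    = (Theta g (c k) * FinRing.uval (alpha g k)) *: bar ThetaM alphaP alphaS (g * k)%g.
  have := tsgr_mul_bar ThetaM alphaP alphaS 1 (c k) g k.
  by rewrite scale1r mul1r.
rewrite {1}(tsgr_basis c) mulr_sumr sum_ffunE (bigD1 h) //= big1 => [|k kh].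
  by rewrite barM addr0 !ffunE eqxx /GRing.scale /= mulr1.
by rewrite barM !ffunE (inj_eq (mulgI g)) eq_sym (negbTE kh) scaler0.
Qed.

(** [Theta g] is injective as a field morphism, and the cocycle value is a unit. *)
Lemma bar_mul_neq0 (gT : finGroupType) (K : finFieldType)
    (Theta : gT -> {rmorphism K -> K}) (alpha : gT -> gT -> {unit K})
    (ThetaM : hom_to_Aut Theta) (alphaP : normalized_cocycle alpha)
    (alphaS : stabilized Theta alpha)
    (c : tsgr ThetaM alphaP alphaS) (g h : gT) :
  ((bar ThetaM alphaP alphaS g * c) (g * h)%g != 0) = (c h != 0).
Proof.
rewrite bar_mulE mulf_eq0 fmorph_eq0 negb_or.
by have := valP (alpha g h); rewrite unitfE => ->; rewrite andbT.
Qed.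

(** Translation by [g] maps the support of [c] bijectively onto that of the product. *)
Lemma weight_bar_mul (gT : finGroupType) (K : finFieldType)
    (Theta : gT -> {rmorphism K -> K}) (alpha : gT -> gT -> {unit K})
    (ThetaM : hom_to_Aut Theta) (alphaP : normalized_cocycle alpha)
    (alphaS : stabilized Theta alpha)
    (c : tsgr ThetaM alphaP alphaS) (g : gT) :
  weight (bar ThetaM alphaP alphaS g * c) = weight c.
Proof.
rewrite /weight -(card_imset [set h | c h != 0] (mulgI g)).
apply: eq_card => k; rewrite -(mulKVg g k) (mem_imset _ _ (mulgI g)) !inE.
exact: bar_mul_neq0.
Qed.

Theorem theorem2p4 (gT : finGroupType) (K : finFieldType)
    (Theta : gT -> {rmorphism K -> K}) (alpha : gT -> gT -> {unit K})
    (ThetaM : hom_to_Aut Theta) (alphaP : normalized_cocycle alpha)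
    (alphaS : stabilized Theta alpha)
    (C : {vspace (tsgr ThetaM alphaP alphaS)}) (C_neq0 : C != 0%VS)
    (C_ideal : left_ideal C) :
  (#|gT| <= min_distance C * \dim C)%N.
Proof.
have [c /andP[cC c0] <-] := min_distance_attained C_neq0.
have [h ch0] : exists h, c h != 0.
  apply/existsP; apply: contraR c0; rewrite negb_exists => /forallP c_eq0.
  by apply/eqP/ffunP => h; have := c_eq0 h; rewrite negbK ffunE => /eqP.
pose X := [seq bar ThetaM alphaP alphaS g * c | g : gT].
have XC : (<<X>> <= C)%VS.
  by apply/span_subvP => _ /mapP[g _ ->]; apply: C_ideal.
(* The translates may span a proper subspace of [C]; its dimension is still a lower bound for that
   of [C]. *)
apply: leq_trans (leq_mul (leqnn _) (dimvS XC)).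
have wX : {in X, forall x : {ffun gT -> K^o},
    (#|[set i | x i != 0%R]| <= weight c)%N}.
  by move=> _ /mapP[g _ ->]; rewrite -(weight_bar_mul c g).
apply: leq_trans (card_supp_span wX).
apply/subset_leq_card/subsetP => k _; rewrite inE; apply/hasP.
(* This translate carries the support point [h] of [c] to [k]. *)
exists (bar ThetaM alphaP alphaS (k * h^-1)%g * c).
  by apply/map_f; rewrite mem_enum.
by rewrite -{2}(mulgKV h k) bar_mul_neq0.
Qed.
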